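(* Let $\mu\ge 0$, $L>0$, $\sigma\ge 0$ and $f\in\mathcal S_{\mu,L}$, with global minimizer $x^\star$. Starting from $x_0=v_0\in\mathbb R^d$, let $(x_k,v_k)_{k\ge0}$ be generated by the SHANG recursion $$\frac{x_{k+1}-x_k}{\alpha_k}=v_k-x_{k+1}-\beta_k g(x_k),\qquad \frac{v_{k+1}-v_k}{\alpha_k}=\frac{\mu}{\gamma_k}(x_{k+1}-v_{k+1})-\frac1{\gamma_k}g(x_{k+1}),\qquad \frac{\gamma_{k+1}-\gamma_k}{\alpha_k}\le\mu-\gamma_{k+1},$$ where the stochastic gradients are conditionally unbiased and satisfy the multiplicative noise scaling (MNS) condition with constant $\sigma$. Let $x_k^+:=x_k-\alpha_k\beta_k g(x_k)$ and set $\beta_k=(1+\sigma^2)\alpha_k/\gamma_k$. (1) If $0<\mu<L<\infty$, take $\alpha_k\equiv\alpha$ and $\gamma_k\equiv\mu$. If $0<\alpha\le\frac{1}{1+\sigma^2}\sqrt{\frac{\mu}{L}}$, then for all $k\ge0$, $$\mathbb E\Big[f(x_{k+1}^+)-f(x^\star)+\frac{\mu}{2}\|v_{k+1}-x^\star\|^2\Big]\le(1+\alpha)^{-(k+1)}\,\mathbb E\Big[f(x_0^+)-f(x^\star)+\frac{\mu}{2}\|v_0-x^\star\|^2\Big].$$ (2) If $\mu=0$, set $\alpha_k=\frac{2}{k+1}$ and $\gamma_k=\alpha_k^2(1+\sigma^2)^2L$. Then for all $k\ge0$, $$\mathbb E\Big[f(x_{k+1}^+)-f(x^\star)+\frac{\gamma_{k+1}}{2}\|v_{k+1}-x^\star\|^2\Big]\le\frac{2}{(k+2)(k+3)}\,\mathbb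 E\Big[f(x_0^+)-f(x^\star)+\frac{\gamma_0}{2}\|v_0-x^\star\|^2\Big].$$
   Context: $\langle\cdot,\cdot\rangle$ and $\|\cdot\|$ are the Euclidean inner product and norm on $\mathbb R^d$. For differentiable $f:\mathbb R^d\to\mathbb R$, let $D_f(y,x)=f(y)-f(x)-\langle\nabla f(x),y-x\rangle$. $\mathcal S_{\mu,L}$ is the class of differentiable $f:\mathbb R^d\to\mathbb R$ that are $\mu$-strongly convex, i.e. $D_f(y,x)\ge\frac\mu2\|y-x\|^2$ for all $x,y$ (for $\mu=0$: convex), and $L$-smooth, i.e. $\|\nabla f(y)-\nabla f(x)\|\le L\|y-x\|$ for all $x,y$. It is assumed that $f$ has a global minimizer, denoted $x^\star$. Stochastic gradients: all random objects live on a complete probability space. For each $k\ge0$, $g(x_k)$ is a random vector in $\mathbb R^d$ (one sample per index $k$; the same sample $g(x_k)$ is used wherever it appears). $\mathcal F_k$ is the $\sigma$-algebra of information available before sampling $g(x_k)$, i.e. generated by the initial data and $g(x_0),\dots,g(x_{k-1})$; thus $x_k$ is $\mathcal F_k$-measurable. In the recursion, $x_k^+$, $x_{k+1}$ and $v_k$ are determined before $g(x_{k+1})$ is sampled and are $\mathcal F_{k+1}$-measurable. Conditional unbiasedness means $\mathbb E[g(x_k)\mid\mathcal F_k]=\nabla f(x_k)$ for all $k\ge0$. The MNS condition with constant $\sigma\ge0$ means $\mathbb E[\|g(x_k)-\nabla f(x_k)\|^2\mid\mathcal F_k]\le\sigma^2\|\nabla f(x_k)\|^2$ for all $k\ge0$.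 All parameters $\alpha_k,\beta_k,\gamma_k$ are deterministic and positive. *)

(* Defs.v *)
From HB Require Import structures.
From mathcomp Require Import all_boot all_order all_algebra.
From mathcomp Require Import all_classical all_reals all_analysis.
From mathcomp Require Import measurable_realfun.

Set Implicit Arguments.
Unset Strict Implicit.
Unset Printing Implicit Defensive.

Import Order.TTheory GRing.Theory Num.Theory.
Import numFieldNormedType.Exports.

Local Open Scope classical_set_scope.
Local Open Scope ring_scope.

(* The library norm `|u| on 'rV[R]_d is the sup norm; its topology, hence
   differentiability, is the usual one, but metric estimates must use [enorm]. *)
Definition dotv (R : realType) (d : nat) (u v : 'rV[R]_d) : R :=
  \sum_(i < d) u 0 i * v 0 i.

Definition enorm (R : realType) (d : nat) (u : 'rV[R]_d) : R :=
  Num.sqrt (dotv u u).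

Definition grad (R : realType) (d : nat) (f : 'rV[R]_d -> R) (x : 'rV[R]_d) :
    'rV[R]_d :=
  \row_(i < d) 'D_(delta_mx 0 i) f x.

Definition bregman (R : realType) (d : nat) (f : 'rV[R]_d -> R)
    (y x : 'rV[R]_d) : R :=
  f y - f x - dotv (grad f x) (y - x).

Record class_S (R : realType) (d : nat) (mu L : R) (f : 'rV[R]_d -> R) :
    Prop := ClassS {
  class_S_differentiable : forall x, differentiable f x ;
  class_S_strongly_convex :
    forall x y, mu / 2 * enorm (y - x) ^+ 2 <= bregman f y x ;
  class_S_smooth :
    forall x y, enorm (grad f y - grad f x) <= L * enorm (y - x) }.

Section stochastic_gradients.
Context (R : realType) (d : nat) (dT : measure_display) (T : measurableType dT).

Definition random_vector (Y : T -> 'rV[R]_d) : Prop :=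
  forall i, measurable_fun setT (fun w => Y w 0 i).

Definition vector_events (Y : T -> 'rV[R]_d) : set (set T) :=
  \bigcup_(i in [set: 'I_d])
    preimage_set_system setT (fun w => Y w 0 i) (measurable : set (set R)).

(* sigma(init, g 0, ..., g (k - 1)) *)
Definition history (init : T -> 'rV[R]_d) (g : nat -> T -> 'rV[R]_d)
    (k : nat) : set (set T) :=
  <<s vector_events init `|` \bigcup_(j in `I_k) vector_events (g j) >>.

(* Y is a version of E[X | G], for G a sub-sigma-algebra and X either
   integrable or nonnegative. *)
Definition is_condexp (P : probability T R) (G : set (set T))
    (X Y : T -> \bar R) : Prop :=
  (forall B : set (\bar R), measurable B -> G (Y @^-1` B)) /\
  forall A, G A -> (\int[P]_(w in A) Y w = \int[P]_(w in A) X w)%E.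

Definition cond_unbiased (P : probability T R) (f : 'rV[R]_d -> R)
    (x g : nat -> T -> 'rV[R]_d) : Prop :=
  forall k i,
    P.-integrable setT (fun w => (g k w 0 i)%:E) /\
    is_condexp P (history (x 0%N) g k)
      (fun w => (g k w 0 i)%:E) (fun w => (grad f (x k w) 0 i)%:E).

Definition MNS (P : probability T R) (f : 'rV[R]_d -> R) (sigma : R)
    (x g : nat -> T -> 'rV[R]_d) : Prop :=
  forall k, exists Y : T -> \bar R,
    is_condexp P (history (x 0%N) g k)
      (fun w => (enorm (g k w - grad f (x k w)) ^+ 2)%:E) Y /\
    {ae P, forall w, (Y w <= (sigma ^+ 2 * enorm (grad f (x k w)) ^+ 2)%:E)%E}.

(* [g k] is the sample g(x_k). *)
Record SHANG (mu : R) (alpha beta gamma : nat -> R) (x0 : 'rV[R]_d)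
    (x v g : nat -> T -> 'rV[R]_d) : Prop := Shang {
  SHANG_x0 : forall w, x 0%N w = x0 ;
  SHANG_v0 : forall w, v 0%N w = x0 ;
  SHANG_x : forall k w,
    (alpha k)^-1 *: (x k.+1 w - x k w)
    = v k w - x k.+1 w - beta k *: g k w ;
  SHANG_v : forall k w,
    (alpha k)^-1 *: (v k.+1 w - v k w)
    = (mu / gamma k) *: (x k.+1 w - v k.+1 w) - (gamma k)^-1 *: g k.+1 w ;
  SHANG_gamma : forall k,
    (gamma k.+1 - gamma k) / alpha k <= mu - gamma k.+1 }.

Definition xplus (alpha beta : nat -> R) (x g : nat -> T -> 'rV[R]_d)
    (k : nat) (w : T) : 'rV[R]_d :=
  x k w - (alpha k * beta k) *: g k w.

End stochastic_gradients.

(* Main.v *)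
Require Import Defs.
From HB Require Import structures.
From mathcomp Require Import all_boot all_order all_algebra.
From mathcomp Require Import all_classical all_reals all_analysis.
From mathcomp Require Import measurable_realfun.
From mathcomp Require Import ring lra.

Set Implicit Arguments.
Unset Strict Implicit.
Unset Printing Implicit Defensive.

Import Order.TTheory GRing.Theory Num.Theory.
Import numFieldNormedType.Exports.

Local Open Scope classical_set_scope.
Local Open Scope ring_scope.

(** The proof follows the energy
      E_k = f (x_k^+) - f xstar + (gamma_k / 2) |v_k - xstar|^2
    along the recursion. The update of x can be rewritten as
    x_(k+1) - x_k^+ = alpha_k (v_k - x_(k+1)), so x_(k+1) and v_k are determined
    before the sample g_(k+1) is drawn. Let n be the gradient of f at x_(k+1)
    and D = g_(k+1) - n the noise. Along every single trajectory,
    [lyapunov_step] gives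
      (1 + alpha_k) E_(k+1) <= E_k + <D, c> + A |D|^2 - B |n|^2
    where c is a linear combination of n, v_k - xstar and x_(k+1) - xstar.
    It comes from three inequalities at the point x_(k+1): the descent
    inequality towards x_(k+1)^+, convexity towards x_k^+, and strong convexity
    towards xstar. What they leave over is a multiple of <n, v_k - x_(k+1)>,
    which is absorbed by completing a square.

    In expectation the term <D, c> vanishes, because c depends on the past only
    and the noise is centered given the past ([noise_orthogonal]); the noise
    condition gives E |D|^2 <= sigma^2 E |n|^2. So E_k contracts in mean by the
    factor 1 / (1 + alpha_k) as soon as sigma^2 A <= B, and
    [noise_coefficients] reduces this to two bounds on
    eta = alpha_(k+1) beta_(k+1): it must be at most 1 / ((1 + sigma^2) L), for
    the gradient step to descend in spite of the noise, and large enough to pay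
    for the noise in v. Both step-size rules satisfy these bounds, and the
    stated rates are the products of the contraction factors.

    For the expectations to be finite all the vectors involved must be square
    integrable. This is an induction ([trajectory_L2]): x_0 and v_0 are
    constant, the gradient is Lipschitz, and the noise condition bounds the
    sample by the gradient. *)

(** * Euclidean inner product *)

Section euclidean.
Context (R : realType) (d : nat).
Implicit Types (u v w : 'rV[R]_d) (a : R).

Lemma dotvC u v : dotv u v = dotv v u.
Proof. by apply: eq_bigr => i _; rewrite mulrC. Qed.

Lemma dotvDl u v w : dotv (u + v) w = dotv u w + dotv v w.
Proof.
by rewrite /dotv -big_split; apply: eq_bigr => i _; rewrite mxE mulrDl.
Qed.

Lemma dotvZl a u v : dotv (a *: u) v = a * dotv u v.
Proof. by rewrite /dotv mulr_sumr; apply: eq_bigr => i _; rewrite mxE mulrA. Qed.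

Lemma dotvNl u v : dotv (- u) v = - dotv u v.
Proof. by rewrite -scaleN1r dotvZl mulN1r. Qed.

Lemma dotvDr u v w : dotv u (v + w) = dotv u v + dotv u w.
Proof. by rewrite dotvC dotvDl !(dotvC u). Qed.

Lemma dotvZr a u v : dotv u (a *: v) = a * dotv u v.
Proof. by rewrite dotvC dotvZl dotvC. Qed.

Lemma dotvNr u v : dotv u (- v) = - dotv u v.
Proof. by rewrite dotvC dotvNl dotvC. Qed.

Definition dotvE := (dotvDl, dotvDr, dotvZl, dotvZr, dotvNl, dotvNr).

Lemma dotv_ge0 u : 0 <= dotv u u.
Proof. by apply: sumr_ge0 => i _; rewrite -expr2 sqr_ge0. Qed.

Lemma enorm_sqr u : enorm u ^+ 2 = dotv u u.
Proof. by rewrite sqr_sqrtr// dotv_ge0. Qed.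

Lemma coord_sqr_le_dotv u i : u 0 i ^+ 2 <= dotv u u.
Proof.
rewrite expr2 /dotv (bigD1 i)//= lerDl.
by apply: sumr_ge0 => j _; rewrite -expr2 sqr_ge0.
Qed.

Lemma dotvD_sqr_le u v : dotv (u + v) (u + v) <= 2 * dotv u u + 2 * dotv v v.
Proof.
have := dotv_ge0 (u - v); rewrite !dotvE (dotvC v u); lra.
Qed.

End euclidean.

(** * The descent inequality *)

Section smooth_convex.
Context (R : realType) (d : nat) (mu L : R) (f : 'rV[R]_d -> R).
Hypotheses (L_gt0 : 0 < L) (mu_ge0 : 0 <= mu) (f_S : class_S mu L f).
Implicit Types (x y h : 'rV[R]_d).

Lemma strongly_convex_le x y :
  f x + dotv (grad f x) (y - x) + mu / 2 * dotv (y - x) (y - x) <= f y.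
Proof.
have := class_S_strongly_convex f_S x y; rewrite enorm_sqr /bregman; lra.
Qed.

Lemma convex_le x y : f x + dotv (grad f x) (y - x) <= f y.
Proof.
apply: le_trans (strongly_convex_le x y); rewrite lerDl.
by rewrite mulr_ge0 ?divr_ge0 ?dotv_ge0.
Qed.

Lemma grad_lipschitz_sqr x y :
  dotv (grad f y - grad f x) (grad f y - grad f x)
    <= L ^+ 2 * dotv (y - x) (y - x).
Proof.
rewrite -!enorm_sqr -exprMn; apply: lerXn2r (class_S_smooth f_S x y).
  by rewrite nnegrE sqrtr_ge0.
by rewrite nnegrE mulr_ge0 ?sqrtr_ge0// ltW.
Qed.

(** Expand |grad f (x + h) - grad f x - L h|^2 >= 0 and use the Lipschitz bound
    on the square of the gradient increment. *)
Lemma grad_increment_le x h :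
  dotv (grad f (x + h)) h <= dotv (grad f x) h + L * dotv h h.
Proof.
have := grad_lipschitz_sqr x (x + h); rewrite [x + h]addrC addrK [h + x]addrC.
move=> lip.
have := dotv_ge0 (grad f (x + h) - grad f x - L *: h).
move: lip; set n' := grad f (x + h); set n := grad f x.
rewrite !dotvE (dotvC n n') (dotvC h n) (dotvC h n') => lip sq.
rewrite -(ler_pM2l L_gt0); nra.
Qed.

(** Convexity alone gives the descent inequality with the constant L in place
    of L / 2, since f (x + h) - f x <= <grad f (x + h), h>. Going from x to
    x + h through the midpoint turns a valid constant L (1/2 + e) into
    L (1/2 + e / 2), the gradients at the two starting points differing by at
    most L |h| / 2. Iterating replaces the usual integration of the gradient
    along the segment. *)
Lemma descent_halving n x h :
  f (x + h) <= f x + dotv (grad f x) h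
               + L * (2^-1 + 2^-1 ^+ n.+1) * dotv h h.
Proof.
elim: n x h => [|n IHn] x h.
  have := convex_le (x + h) x; rewrite opprD addNKr dotvNr.
  have := grad_increment_le x h; rewrite expr1; lra.
pose k := 2^-1 *: h.
have hE : h = k + k by rewrite /k -scalerDl (_ : 2^-1 + 2^-1 = 1) ?scale1r//; lra.
have := grad_increment_le x k; have := IHn x k; have := IHn (x + k) k.
rewrite -addrA -hE [dotv (grad f x) h](_ : _ = 2 * dotv (grad f x) k); last first.
  by rewrite hE dotvDr; ring.
have -> : dotv h h = 4 * dotv k k by rewrite hE !dotvE; ring.
rewrite [in X in _ -> _ -> _ -> X]exprS; move: (_ ^+ n.+1) => e; lra.
Qed.

Lemma descent_le x y :
  f y <= f x + dotv (grad f x) (y - x) + L / 2 * dotv (y - x) (y - x).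
Proof.
apply/ler_addgt0Pr => e e0; set h := y - x.
pose c := L * dotv h h.
have c0 : 0 <= c by rewrite mulr_ge0 ?dotv_ge0 ?ltW.
have c1 : 0 < c + 1 by rewrite ltr_wpDl.
have [n _ /(_ n (leqnn n))/= ne] :=
  near_infty_natSinv_expn_lt (PosNum (divr_gt0 e0 c1)).
have := descent_halving n x h; rewrite /h addrC subrK -/h.
have : c * 2^-1 ^+ n.+1 <= e.
  move: ne; rewrite div1r -exprVn ltr_pdivlMr// exprS => ne.
  have : 0 <= (2^-1 : R) ^+ n by rewrite exprn_ge0.
  move: ne; move: (_ ^+ n) => q; nra.
rewrite /c; move: (_ ^+ n.+1) => q; lra.
Qed.

End smooth_convex.

(** * One step along a trajectory *)

Section lyapunov_step.
Context (R : realType) (d : nat) (mu L : R) (f : 'rV[R]_d -> R).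
Hypotheses (L_gt0 : 0 < L) (mu_ge0 : 0 <= mu) (f_S : class_S mu L f).

(** Here y stands for x_k^+, (X, V) for the next iterates, G for the sample
    taken at X, n for the gradient at X and D for the noise. Before the sample
    enters, V is the barycenter of v and X with weights ga / gh and
    al * mu / gh. The two sides differ exactly by a nonnegative combination of
    the descent inequality, convexity towards y, strong convexity towards
    xstar, the bound on ga', and the square |al n - ga (v - X)|^2; the last one
    absorbs the inner product <n, v - X>, which appears because the barycenter
    is not v. *)
Lemma lyapunov_step (xstar y v X V G n D c : 'rV[R]_d) (al ga ga' eta gh : R) :
  0 < al -> 0 < ga ->
  gh = ga + al * mu ->
  (1 + al) * ga' <= gh ->
  X - y = al *: (v - X) ->
  V = gh^-1 *: (ga *: v + (al * mu) *: X - al *: G) ->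
  n = grad f X ->
  D = G - n ->
  c = ((1 + al) * (L * eta ^+ 2 - eta) + al ^+ 2 / gh) *: n
      - (al / gh) *: (ga *: (v - xstar) + (al * mu) *: (X - xstar)) ->
  (1 + al) * (f (X - eta *: G) - f xstar
              + ga' / 2 * dotv (V - xstar) (V - xstar))
  <= f y - f xstar + ga / 2 * dotv (v - xstar) (v - xstar)
     + dotv D c
     + ((1 + al) * (L * eta ^+ 2 / 2) + al ^+ 2 / (2 * gh)) * dotv D D
     - ((1 + al) * (eta - L * eta ^+ 2 / 2) - al ^+ 2 / (2 * gh)
        - al ^+ 3 * mu / (2 * gh * ga)) * dotv n n.
Proof.
move=> al0 ga0 ghE hga Xy VE nE DE cE.
have almu : 0 <= al * mu by rewrite mulr_ge0// ltW.
have gh0 : 0 < gh by rewrite ghE ltr_wpDr.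
pose p := v - X; pose q := X - xstar.
have GE : G = n + D by rewrite DE addrC subrK.
have vE : v - xstar = p + q by rewrite /p /q addrA subrK.
have yX : y - X = - al *: p by rewrite scaleNr -Xy opprB.
have VqE : V - xstar = q + (ga / gh) *: p - (al / gh) *: (n + D).
  rewrite VE -GE; apply/rowP => i; rewrite /q /p !mxE ghE; field.
  by rewrite -ghE gt_eqF.
have H1 := descent_le L_gt0 mu_ge0 f_S X (X - eta *: G).
have H2 := convex_le mu_ge0 f_S X y.
have H3 := strongly_convex_le f_S X xstar.
have H4 : (1 + al) * (ga' / 2 * dotv (V - xstar) (V - xstar))
          <= gh / 2 * dotv (V - xstar) (V - xstar).
  by rewrite mulrA ler_wpM2r ?dotv_ge0// mulrA ler_pM2r.
have H5 := dotv_ge0 (al *: n - ga *: p).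
have H6 : 0 <= al * mu / (2 * ga * gh) by rewrite divr_ge0// !mulr_ge0// ltW.
have {H5 H6} := mulr_ge0 H6 H5.
have {}H1 := ler_wpM2l (addr_ge0 ler01 (ltW al0)) H1.
have {}H3 := ler_wpM2l (ltW al0) H3.
move: H1 H2 H3 H4.
rewrite [X - eta *: G - X]addrC addKr yX -(opprB X) -/q GE.
rewrite cE vE VqE -/q -nE; clearbody p q.
rewrite !dotvE (dotvC p n) (dotvC D n) (dotvC q n) (dotvC D p) (dotvC D q).
rewrite (dotvC q p).
move=> H1 H2 H3 H4 H5; rewrite -subr_ge0.
rewrite -subr_ge0 in H1; rewrite -subr_ge0 in H2.
rewrite -subr_ge0 in H3; rewrite -subr_ge0 in H4.
(* The sum of the five inequalities is equal to the claim. *)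
apply: le_trans (addr_ge0 (addr_ge0 (addr_ge0 H1 H2) (addr_ge0 H3 H4)) H5) _.
rewrite le_eqVlt; apply/orP; left; apply/eqP.
rewrite ghE; field.
by rewrite -ghE !gt_eqF.
Qed.

End lyapunov_step.

(** * Continuous functions of random vectors *)

Section continuous_measurable.
Context (R : realType) (d : nat) (dT : measure_display) (T : measurableType dT).

Lemma measurable_ball_preimage (Y : T -> 'rV[R]_d) (c : 'rV[R]_d) (r : R) :
  0 < r -> random_vector Y -> measurable (Y @^-1` ball c r).
Proof.
move=> r0 mY.
rewrite [X in measurable X](_ : _ =
    \bigcap_(i in [set: 'I_d]) ((fun w => Y w 0 i) @^-1` ball (c 0 i) r)).
  apply: fin_bigcap_measurable => // i _.
  by rewrite -[X in measurable X]setTI; apply: mY => //; exact: measurable_ball.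
apply/seteqP; split => w /=; first by move=> [_ Yc] i _; exact: Yc.
by move=> Yc; split => // j i; rewrite ord1; exact: Yc.
Qed.

(** Measurability of a random vector is only known coordinatewise. An open set
    of R^d is the union of the balls with rational centers and radii 1 / (n + 1)
    that it contains; there are countably many of them, and balls are boxes
    because the ambient norm is the sup norm. *)
Lemma continuous_random_vector (f : 'rV[R]_d -> R) (Y : T -> 'rV[R]_d) :
  continuous f -> random_vector Y -> measurable_fun setT (fun w => f (Y w)).
Proof.
move=> /continuousP cf mY.
apply: (measurability _ (RGenOpens.measurableE R)) => //.
move=> _ [_ [a [b ->] <-]]; rewrite setTI.
set O := f @^-1` `]a, b[%classic.
have oO : open O by apply: cf; exact: interval_open.
rewrite [X in measurable X](_ : _ = Y @^-1` O)//.
pose q_ (q : {ffun 'I_d -> rat}) : 'rV[R]_d := \row_i ratr (q i).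
pose B (p : {ffun 'I_d -> rat} * nat) : set 'rV[R]_d :=
  if pselect (ball (q_ p.1) p.2.+1%:R^-1 `<=` O)
  then ball (q_ p.1) p.2.+1%:R^-1 else set0.
have -> : Y @^-1` O = \bigcup_p (Y @^-1` B p).
  apply/seteqP; split => [w Ow|w [p _]]; last first.
    by rewrite /B /=; case: pselect => //= pO /pO.
  have /nbhs_ballP[e /= e0 eO] := open_nbhs_nbhs (conj oO Ow).
  have e20 : 0 < e / 2 by rewrite divr_gt0.
  have [n _ /(_ n (leqnn n))/= ne] := near_infty_natSinv_lt (PosNum e20).
  have n0 : 0 < n.+1%:R^-1 :> R by rewrite invr_gt0.
  have qex i : {q : rat | ratr q \in `](Y w 0 i - n.+1%:R^-1), (Y w 0 i)[}.
    by apply: cid; apply: rat_in_itvoo; rewrite gtrBl.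
  pose q := [ffun i => sval (qex i)].
  have qY : ball (q_ q) n.+1%:R^-1 (Y w).
    split => // j i; rewrite ord1 mxE ffunE /ball /=.
    case: (qex i) => r /=; rewrite in_itv/= => /andP[r1 r2].
    by rewrite ltr0_norm ?subr_lt0// opprB ltrBlDr addrC -ltrBlDr.
  exists (q, n) => //=; rewrite /B /=; case: pselect => //= -[].
  apply: subset_trans eO => z qz.
  apply: (@le_ball _ _ _ (n.+1%:R^-1 + n.+1%:R^-1)).
    by rewrite [leRHS]splitr lerD// ltW.
  exact: ball_triangle (ball_sym qY) qz.
apply: countable_bigcupT_measurable => // p.
rewrite /B; case: pselect => _ /=; last by rewrite preimage_set0.
by apply: measurable_ball_preimage; rewrite ?invr_gt0.
Qed.

End continuous_measurable.

(** * Square integrable random variables *)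

Section square_integrable.
Context (R : realType) (dT : measure_display) (T : measurableType dT).
Context (P : probability T R).
Implicit Types X Y Z : T -> R.

Local Notation L2 := (Lfun P 2%:E).

Lemma Lfun2_measurable X : X \in L2 -> measurable_fun setT X.
Proof. by rewrite inE => /andP[]; rewrite inE. Qed.

Lemma Lfun2_sqr_le X Z : measurable_fun setT X ->
  P.-integrable setT (EFin \o Z) -> (forall w, X w ^+ 2 <= Z w) -> X \in L2.
Proof.
move=> mX iZ XZ.
have iX : P.-integrable setT (EFin \o (fun w => X w ^+ 2)).
  apply: le_integrable iZ => //.
    by apply/measurable_EFinP; exact: measurable_funX.
  move=> w _ /=; rewrite lee_fin ger0_norm ?sqr_ge0//.
  exact: le_trans (XZ w) (ler_norm _).
rewrite inE; apply/andP; split; first by rewrite inE.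
rewrite inE /= /finite_norm unlock /Lnorm poweR_lty//.
have /integrableP[_] := iX; apply: le_lt_trans.
rewrite le_eqVlt; apply/orP; left; apply/eqP.
by apply: eq_integral => w _ /=; rewrite powR_mulrn// normrX.
Qed.

Lemma Lfun2D X Y : X \in L2 -> Y \in L2 -> (fun w => X w + Y w) \in L2.
Proof.
by move=> X2 Y2; have [_] := Lfun_addr_closed P (lee1n 2); exact.
Qed.

Lemma Lfun2Z a X : X \in L2 -> (fun w => a * X w) \in L2.
Proof.
move=> X2; rewrite (_ : (fun w => _) = a \o* X); last first.
  by apply/funext => w /=; rewrite mulrC.
by apply: Lfun_scale X2; rewrite ler1n.
Qed.

Lemma Lfun2_cst (a : R) : (fun _ : T => a) \in L2.
Proof. exact: Lfun_cst. Qed.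

Lemma Lfun2_integrableM X Y : X \in L2 -> Y \in L2 ->
  P.-integrable setT (EFin \o (fun w => X w * Y w)).
Proof. by move=> X2 Y2; apply/Lfun1_integrable; exact: Lfun2_mul_Lfun1. Qed.

End square_integrable.

(** * Centered variables given a sub-sigma-algebra *)

Section pull_out.
Import HBNNSimple.
Context (R : realType) (dT : measure_display) (T : measurableType dT).
Context (P : {measure set T -> \bar R}).
Variables (G : set (set T)) (D : T -> R).
Hypothesis G_measurable : <<s G >> `<=` measurable.
Hypothesis D_integrable : P.-integrable setT (EFin \o D).
Hypothesis D_centered : forall A, <<s G >> A -> (\int[P]_(w in A) (D w)%:E = 0)%E.

Lemma sub_sigma_measurable (h : g_sigma_algebraType G -> R) :
  measurable_fun setT h -> measurable_fun [set: T] (h : T -> R).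
Proof.
move=> mh _ B mB; rewrite setTI; apply: G_measurable.
by rewrite -[X in <<s _ >> X]setTI; exact: mh.
Qed.

Lemma integral_indic_centered A : <<s G >> A ->
  P.-integrable setT (fun w => (\1_A w * D w)%:E) /\
  (\int[P]_w (\1_A w * D w)%:E = 0)%E.
Proof.
move=> GA; have mA := G_measurable GA.
have E : (EFin \o D) \_ A = (fun w => (\1_A w * D w)%:E).
  by apply/funext => w; rewrite epatch_indic /= -EFinM mulrC.
rewrite -E; split; last by rewrite -integral_mkcond D_centered.
by apply/(integrable_mkcond _ mA); exact: integrableS D_integrable.
Qed.

(** A simple function is a combination of indicators of sets of <<s G >>. *)
Lemma integral_simple_centered (s : {nnsfun (g_sigma_algebraType G) >-> R}) :
  (\int[P]_w (s w * D w)%:E = 0)%E.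
Proof.
have sG a : <<s G >> (s @^-1` [set a]).
  exact: measurable_funPTI s _ (measurable_set1 a).
pose F (i : nat) (w : T) :=
  let a := (finmap.enum_fset (fset_set (range s)))`_i in
  (a%:E * (\1_(s @^-1` [set a]) w * D w)%:E)%E.
have iF i : P.-integrable setT (F i).
  by apply: integrableZl => //; exact: (integral_indic_centered (sG _)).1.
under eq_integral => w _.
  rewrite fimfunEord mulr_suml -sumEFin.
  under eq_bigr => i _ do rewrite -mulrA EFinM -/(F i w).
  over.
rewrite integral_sum// big1// => i _.
rewrite integralZl//; last exact: (integral_indic_centered (sG _)).1.
by rewrite (integral_indic_centered (sG _)).2 mule0.
Qed.

Lemma integral_ge0_centered (h : g_sigma_algebraType G -> R) :
  measurable_fun setT h -> (forall w, 0 <= h w) ->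
  P.-integrable setT (fun w => (h w * D w)%:E) ->
  (\int[P]_w (h w * D w)%:E = 0)%E.
Proof.
move=> mh h0 ihD.
have meh : measurable_fun [set: g_sigma_algebraType G] (EFin \o h).
  exact/measurable_EFinP.
pose s := nnsfun_approx measurableT meh.
have s_cvg w : (fun n => s n w) @ \oo --> h w.
  by have /fine_cvgP[_] :=
    cvg_nnsfun_approx measurableT meh (fun x _ => h0 x) (I : setT w).
have s_le n w : s n w <= h w.
  rewrite -(cvg_lim _ (s_cvg w))//.
  apply: (@nondecreasing_cvgn_le _ (fun n => s n w)); last first.
    by apply/cvg_ex; exists (h w).
  by move=> m k mk; exact/lefP/nd_nnsfun_approx.
have mD : measurable_fun setT D.
  by apply/measurable_EFinP; exact: measurable_int D_integrable.
have msD n : measurable_fun [set: T] (fun w : T => (s n w * D w)%:E).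
  apply/measurable_EFinP; apply: measurable_funM => //.
  exact: (sub_sigma_measurable (@measurable_funPT _ _ _ _ (s n))).
have mhD : measurable_fun [set: T] (fun w : T => (h w * D w)%:E).
  exact: measurable_int ihD.
have [||_ _] := dominated_convergence measurableT msD mhD _ (integrable_abse ihD).
- apply/nearW => w _; apply/fine_cvgP; split; first exact: nearW.
  exact: cvgMr_tmp (s_cvg w).
- apply/nearW => w n _ /=; rewrite lee_fin !normrM ler_wpM2r//.
  by rewrite !ger0_norm.
rewrite (_ : [sequence _]_n = cst 0%E); last first.
  by apply/funext => n /=; exact: integral_simple_centered.
move=> /(cvg_lim (@ereal_hausdorff _)) <-.
by rewrite lim_cst//; exact: ereal_hausdorff.
Qed.

(** The pull-out property of conditional expectations, for a variable whose
    conditional expectation given <<s G >> is zero: indicators, then simple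
    functions, then nonnegative functions by dominated convergence along
    simple functions below h, then the two parts of h. *)
Lemma integral_centered (h : g_sigma_algebraType G -> R) :
  measurable_fun setT h -> P.-integrable setT (fun w => (h w * D w)%:E) ->
  (\int[P]_w (h w * D w)%:E = 0)%E.
Proof.
move=> mh ihD.
have mD : measurable_fun setT D.
  by apply/measurable_EFinP; exact: measurable_int D_integrable.
have part (u : g_sigma_algebraType G -> R) : measurable_fun setT u ->
    (forall w, `|u w| <= `|h w|) ->
    P.-integrable setT (fun w => (u w * D w)%:E).
  move=> mu uh; apply: le_integrable ihD => //.
    apply/measurable_EFinP; apply: measurable_funM => //.
    exact: sub_sigma_measurable mu.
  by move=> w _; rewrite /= lee_fin !normrM ler_wpM2r.
have ipos : P.-integrable setT (fun w => (h^\+ w * D w)%:E).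
  apply: part => [|w]; first exact: measurable_funrpos.
  by rewrite /funrpos /Order.max; case: ifPn; rewrite ?normr0.
have ineg : P.-integrable setT (fun w => (h^\- w * D w)%:E).
  apply: part => [|w]; first exact: measurable_funrneg.
  by rewrite /funrneg /Order.max; case: ifPn; rewrite ?normr0 ?normrN.
have -> : (fun w => (h w * D w)%:E)
    = ((fun w => (h^\+ w * D w)%:E) \- (fun w => (h^\- w * D w)%:E))%E.
  apply/funext => w; rewrite /= -EFinB -mulrBl.
  by have /(congr1 (fun u => u w)) /= <- := funrposBneg h.
rewrite integralB//.
rewrite (integral_ge0_centered (measurable_funrpos mh) (funrpos_ge0 h) ipos).
rewrite (integral_ge0_centered (measurable_funrneg mh) (funrneg_ge0 h) ineg).
by rewrite sube0.
Qed.

End pull_out.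

(** * Random vectors, coordinate by coordinate *)

Section coordinates.
Context (R : realType) (d : nat) (T : Type).

Definition coordwise (K : set (T -> R)) (Y : T -> 'rV[R]_d) : Prop :=
  forall i, K (fun w => Y w 0 i).

(** Square integrable and past-measurable functions both form such a class;
    every iterate is an affine combination of earlier ones, so either property
    propagates along the recursion by the same lemmas. *)
Definition affine_closed (K : set (T -> R)) : Prop :=
  (forall a, K (fun=> a)) /\
  (forall a u v, K u -> K v -> K (fun w => a * u w + v w)).

Variable K : set (T -> R).
Hypothesis K_affine : affine_closed K.

Lemma coordwise_cst c : coordwise K (fun=> c).
Proof. by move=> i; apply: K_affine.1. Qed.

Lemma coordwiseZ a U : coordwise K U -> coordwise K (fun w => a *: U w).
Proof.
move=> KU i; have := K_affine.2 a _ _ (KU i) (K_affine.1 0).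
by congr K; apply/funext => w; rewrite mxE addr0.
Qed.

Lemma coordwiseD U V :
  coordwise K U -> coordwise K V -> coordwise K (fun w => U w + V w).
Proof.
move=> KU KV i; have := K_affine.2 1 _ _ (KU i) (KV i).
by congr K; apply/funext => w; rewrite mxE mul1r.
Qed.

Lemma coordwiseB U V :
  coordwise K U -> coordwise K V -> coordwise K (fun w => U w - V w).
Proof.
move=> KU /(coordwiseZ (-1)) KV; under eq_fun do rewrite -scaleN1r.
exact: coordwiseD.
Qed.

End coordinates.

Section random_vectors.
Context (R : realType) (d : nat) (dT : measure_display) (T : measurableType dT).
Context (P : probability T R).
Implicit Types U V : T -> 'rV[R]_d.

Lemma measurable_affine (dS : measure_display) (S : measurableType dS) :
  affine_closed [set u : S -> R | measurable_fun setT u].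
Proof.
split => [a|a u v mu mv]; first exact: measurable_cst.
by apply: measurable_funD => //; apply: measurable_funM.
Qed.

Lemma Lfun2_affine : affine_closed [set u : T -> R | u \in Lfun P 2%:E].
Proof.
split => [a|a u v u2 v2]; first exact: Lfun2_cst.
by apply: Lfun2D => //; exact: Lfun2Z.
Qed.

Definition L2_vector := coordwise [set u : T -> R | u \in Lfun P 2%:E] (d := d).

Lemma L2_vectorB_cst U c : L2_vector U -> L2_vector (fun w => U w - c).
Proof.
move=> U2; apply: (coordwiseB Lfun2_affine U2).
exact: coordwise_cst Lfun2_affine _.
Qed.

Lemma L2_vector_random U : L2_vector U -> random_vector U.
Proof. by move=> U2 i; exact: Lfun2_measurable (U2 i). Qed.

Lemma measurable_dotv U V : random_vector U -> random_vector V ->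
  measurable_fun setT (fun w => dotv (U w) (V w)).
Proof.
by move=> mU mV; apply: measurable_sum => i; exact: measurable_funM.
Qed.

Lemma integrable_dotv U V : L2_vector U -> L2_vector V ->
  P.-integrable setT (EFin \o (fun w => dotv (U w) (V w))).
Proof.
move=> U2 V2.
rewrite (_ : _ \o _ = (fun w => \sum_(i < d) (U w 0 i * V w 0 i)%:E)%E).
  by apply: integrable_sum => // i _; exact: Lfun2_integrableM (U2 i) (V2 i).
by apply/funext => w; rewrite /= sumEFin.
Qed.

Lemma L2_vector_sqr U Z : random_vector U ->
  P.-integrable setT (EFin \o Z) ->
  (forall w, dotv (U w) (U w) <= Z w) -> L2_vector U.
Proof.
move=> mU iZ UZ i; apply: Lfun2_sqr_le iZ _; first exact: mU.
by move=> w; exact: le_trans (coord_sqr_le_dotv _ _) (UZ w).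
Qed.

Lemma integrable_funZ a (X : T -> R) : P.-integrable setT (EFin \o X) ->
  P.-integrable setT (EFin \o (fun w => a * X w)).
Proof. exact: integrableZl. Qed.

Lemma integrable_funD (X Y : T -> R) :
  P.-integrable setT (EFin \o X) -> P.-integrable setT (EFin \o Y) ->
  P.-integrable setT (EFin \o (fun w => X w + Y w)).
Proof. exact: integrableD. Qed.

Lemma expectationE (X : T -> R) : P.-integrable setT (EFin \o X) ->
  ('E_P[X] = (\int[P]_w X w)%R%:E)%E.
Proof. by move=> iX; rewrite unlock fineK//; exact: integrable_fin_num. Qed.

End random_vectors.

(** * Conditional expectations *)

Section condexp.
Context (R : realType) (d : nat) (dT : measure_display) (T : measurableType dT).
Context (P : probability T R).
Variables (G : set (set T)).
Hypothesis G_measurable : <<s G >> `<=` measurable.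

Definition adapted := coordwise
  [set u : T -> R | measurable_fun [set: g_sigma_algebraType G] u] (d := d).

Lemma adapted_random U : adapted U -> random_vector U.
Proof. by move=> aU i; exact: sub_sigma_measurable (aU i). Qed.

Lemma is_condexp_measurable (X : T -> \bar R) (Y : T -> \bar R) :
  is_condexp P <<s G >> X Y -> measurable_fun [set: g_sigma_algebraType G] Y.
Proof. by move=> [mY _] _ B mB; rewrite setTI; exact: mY. Qed.

Lemma noise_orthogonal (g n c : T -> 'rV[R]_d) :
  L2_vector P g -> L2_vector P n -> L2_vector P c -> adapted c ->
  (forall i, is_condexp P <<s G >> (fun w => (g w 0 i)%:E)
                                   (fun w => (n w 0 i)%:E)) ->
  \int[P]_w dotv (g w - n w) (c w) = 0.
Proof.
move=> g2 n2 c2 ac gn.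
have L1 (u : T -> R) : u \in Lfun P 2%:E -> P.-integrable setT (EFin \o u).
  by move=> u2; apply/Lfun1_integrable/Lfun_subset12 => //;
    exact: fin_num_measure.
have D2 := coordwiseB (Lfun2_affine P) g2 n2.
rewrite /Rintegral.
under eq_integral => w _.
  rewrite /dotv -sumEFin; under eq_bigr => i _ do rewrite mulrC; over.
rewrite integral_sum//; last first.
  by move=> i; exact: Lfun2_integrableM (c2 i) (D2 i).
rewrite big1// => i _.
apply: (integral_centered (G := G) (D := fun w => (g w - n w) 0 i)) => //.
- exact: L1 (D2 i).
- move=> A GA; have mA := G_measurable GA.
  under eq_integral do rewrite !mxE EFinB.
  rewrite integralB//; last 2 first.
  + by apply: integrableS (L1 _ (g2 i)).
  + by apply: integrableS (L1 _ (n2 i)).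
  rewrite (gn i).2// subee//; apply: integrable_fin_num => //.
  by apply: integrableS (L1 _ (g2 i)).
- exact: ac.
- exact: Lfun2_integrableM (c2 i) (D2 i).
Qed.

(** The conditional expectation Y is only known to be below Z, so it is compared
    through its positive part. *)
Lemma condexp_le_integral (X : T -> \bar R) (Y : T -> \bar R) (Z : T -> R) :
  is_condexp P <<s G >> X Y ->
  P.-integrable setT (EFin \o Z) -> (forall w, 0 <= Z w) ->
  {ae P, forall w, (Y w <= (Z w)%:E)%E} ->
  (\int[P]_w X w <= (\int[P]_w Z w)%:E)%E.
Proof.
move=> YX iZ Z0 YZ.
have mY : measurable_fun [set: T] Y.
  move=> _ B mB; rewrite setTI; apply: G_measurable.
  exact: YX.1.
rewrite -(YX.2 setT); last exact: (@measurableT _ (g_sigma_algebraType G)).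
rewrite fineK; last exact: integrable_fin_num.
apply: (@le_trans _ _ (\int[P]_w Y^\+ w)%E).
  by rewrite integralE; apply: geeDl; rewrite leeNl oppe0 integral_ge0.
apply: ae_ge0_le_integral => //.
- exact: measurable_funepos.
- by move=> w _; rewrite lee_fin.
- exact: measurable_int iZ.
apply: filterS YZ => w YZ _; rewrite funeposE ge_max YZ /=.
by rewrite lee_fin.
Qed.

End condexp.

(** * Step sizes that dominate the noise *)

Section step_size.
Context (R : realType).

(** A and the right-hand side are the coefficients A and B of
    [lyapunov_step]; s2 stands for sigma^2. *)
Lemma noise_coefficients (mu L s2 al ga gh eta : R) :
  0 <= L -> 0 < al -> 0 < ga -> 0 < gh -> 0 <= eta ->
  L * (1 + s2) * eta <= 1 ->
  (1 + s2) * (al ^+ 2 / gh) + al ^+ 3 * mu / (gh * ga) <= (1 + al) * eta ->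
  let A := (1 + al) * (L * eta ^+ 2 / 2) + al ^+ 2 / (2 * gh) in
  0 <= A /\
  s2 * A <= (1 + al) * (eta - L * eta ^+ 2 / 2) - al ^+ 2 / (2 * gh)
            - al ^+ 3 * mu / (2 * gh * ga).
Proof.
move=> L_ge0 al_gt0 ga_gt0 gh_gt0 eta_ge0 eta_le eta_ge A.
have [al_ge0 gh_ge0] := (ltW al_gt0, ltW gh_gt0).
split.
  by rewrite !(addr_ge0, mulr_ge0, invr_ge0, sqr_ge0).
have ga_neq0 := lt0r_neq0 ga_gt0; have gh_neq0 := lt0r_neq0 gh_gt0.
have -> : A = (1 + al) * (L * eta ^+ 2 / 2) + al ^+ 2 / gh / 2.
  by rewrite /A; field.
have -> : al ^+ 2 / (2 * gh) = al ^+ 2 / gh / 2 by field.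
have -> : al ^+ 3 * mu / (2 * gh * ga) = al ^+ 3 * mu / (gh * ga) / 2.
  by field; rewrite ga_neq0.
have w0 : 0 <= (1 + al) * eta / 2 by rewrite divr_ge0 ?mulr_ge0 ?addr_ge0.
have := ler_wpM2r w0 eta_le; move: eta_ge.
move: (al ^+ 2 / gh) (al ^+ 3 * mu / _) => q1 q2; lra.
Qed.

End step_size.

(** * Trajectories of the SHANG recursion *)

Section trajectory.
Context (R : realType) (d : nat) (dT : measure_display) (T : measurableType dT).
Context (P : probability T R) (mu L sigma : R) (f : 'rV[R]_d -> R).
Context (xstar x0 : 'rV[R]_d) (alpha beta gamma : nat -> R).
Context (x v g : nat -> T -> 'rV[R]_d).
Hypotheses (mu_ge0 : 0 <= mu) (L_gt0 : 0 < L).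
Hypotheses (f_S : class_S mu L f) (xstar_min : forall y, f xstar <= f y).
Hypotheses (alpha_gt0 : forall k, 0 < alpha k).
Hypotheses (gamma_gt0 : forall k, 0 < gamma k).
Hypotheses (g_random : forall k, random_vector (g k)).
Hypotheses (xv_SHANG : SHANG mu alpha beta gamma x0 x v g).
Hypotheses (g_unbiased : cond_unbiased P f x g) (g_MNS : MNS P f sigma x g).

(** [history (x 0) g k] is <<s past k >>; naming the generators gives the past
    a measurable space structure through [g_sigma_algebraType]. *)
Definition past k : set (set T) :=
  vector_events (x 0%N) `|` \bigcup_(j in `I_k) vector_events (g j).

Local Notation xp := (xplus alpha beta x g).

Let n_ k w := grad f (x k w).
Let D_ k w := g k w - n_ k w.

Lemma past_measurable k : <<s past k >> `<=` measurable.
Proof.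
apply: smallest_sub; first exact: sigma_algebra_measurable.
have mx : random_vector (x 0%N).
  move=> i; under eq_fun do rewrite (SHANG_x0 xv_SHANG).
  exact: measurable_cst.
move=> A [[i _ [B mB <-]]|[j _ [i _ [B mB <-]]]]; first exact: mx.
exact: g_random.
Qed.

Lemma past_monotone k m (U : T -> 'rV[R]_d) :
  (k <= m)%N -> adapted (past k) U -> adapted (past m) U.
Proof.
move=> km aU i _ B mB; have := aU i measurableT B mB.
apply: sub_sigma_algebra2; apply: setUS => A [j jk gA]; exists j => //.
exact: leq_trans jk km.
Qed.

Lemma sample_adapted j k : (j < k)%N -> adapted (past k) (g j).
Proof.
move=> jk i _ B mB; apply: sub_sigma_algebra; right; exists j => //.
by exists i => //; exists B.
Qed.

Lemma x_minus_xplus k w : x k.+1 w - xp k w = alpha k *: (v k w - x k.+1 w).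
Proof.
have a0 := lt0r_neq0 (alpha_gt0 k).
have := congr1 (fun u => alpha k *: u) (SHANG_x xv_SHANG k w).
rewrite /= scalerA mulfV// scale1r scalerBr => E.
by rewrite /xplus opprB addrCA E scalerA addrC subrK.
Qed.

Lemma x_recursion k w :
  x k.+1 w = (1 + alpha k)^-1 *: (xp k w + alpha k *: v k w).
Proof.
have a1 : 1 + alpha k != 0 by rewrite gt_eqF// ltr_pwDl// ltW.
have E := x_minus_xplus k w.
apply: (scalerI a1); rewrite scalerA mulfV// scale1r scalerDl scale1r.
apply/eqP; rewrite eq_sym -subr_eq -addrA -scalerBr -E.
by rewrite addrC subrK.
Qed.

Lemma v_recursion k w :
  v k.+1 w = (gamma k + alpha k * mu)^-1 *:
    (gamma k *: v k w + (alpha k * mu) *: x k.+1 w - alpha k *: g k.+1 w).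
Proof.
have a0 := lt0r_neq0 (alpha_gt0 k); have g0 := lt0r_neq0 (gamma_gt0 k).
have gh0 : gamma k + alpha k * mu != 0.
  by rewrite gt_eqF// ltr_pwDl// mulr_ge0// ltW.
apply/rowP => i; have /rowP/(_ i) := SHANG_v xv_SHANG k w; rewrite !mxE => E.
apply: (mulfI gh0); rewrite mulVKf//.
have := congr1 (fun t => gamma k * alpha k * t) E => {}E.
have E1 : gamma k * alpha k * ((alpha k)^-1 * (v k.+1 w 0 i - v k w 0 i))
  = gamma k * (v k.+1 w 0 i - v k w 0 i) by field.
have E2 : gamma k * alpha k * (mu / gamma k * (x k.+1 w 0 i - v k.+1 w 0 i)
             - (gamma k)^-1 * g k.+1 w 0 i)
  = alpha k * (mu * (x k.+1 w 0 i - v k.+1 w 0 i) - g k.+1 w 0 i) by field.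
move: E; rewrite /= E1 E2; lra.
Qed.

Lemma xplus_coordwise K : affine_closed K -> forall k,
  coordwise K (x k) -> coordwise K (g k) -> coordwise K (xp k).
Proof. by move=> Ka k Kx Kg; apply: coordwiseB => //; exact: coordwiseZ. Qed.

Lemma x_coordwise K : affine_closed K -> forall k,
  coordwise K (x k) -> coordwise K (g k) -> coordwise K (v k) ->
  coordwise K (x k.+1).
Proof.
move=> Ka k Kx Kg Kv; rewrite [x k.+1](funext (x_recursion k)).
apply: (coordwiseZ Ka); apply: (coordwiseD Ka); last exact: coordwiseZ.
exact: xplus_coordwise.
Qed.

Lemma v_coordwise K : affine_closed K -> forall k,
  coordwise K (x k.+1) -> coordwise K (g k.+1) -> coordwise K (v k) ->
  coordwise K (v k.+1).
Proof.
move=> Ka k Kx Kg Kv; rewrite [v k.+1](funext (v_recursion k)).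
apply: (coordwiseZ Ka); apply: (coordwiseB Ka); last exact: coordwiseZ.
by apply: (coordwiseD Ka); exact: coordwiseZ.
Qed.

Lemma x0_coordwise K : affine_closed K -> coordwise K (x 0%N).
Proof.
by move=> Ka; rewrite [x 0%N](funext (SHANG_x0 xv_SHANG)); exact: coordwise_cst.
Qed.

Lemma v0_coordwise K : affine_closed K -> coordwise K (v 0%N).
Proof.
by move=> Ka; rewrite [v 0%N](funext (SHANG_v0 xv_SHANG)); exact: coordwise_cst.
Qed.

(** The indices differ: v_k uses the sample g_k, x_k does not. *)
Lemma trajectory_adapted k :
  adapted (past k) (x k) /\ adapted (past k.+1) (v k).
Proof.
elim: k => [|k [ax av]].
  by split; [apply: x0_coordwise|apply: v0_coordwise]; exact: measurable_affine.
have ax' : adapted (past k.+1) (x k.+1).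
  apply: x_coordwise => //; first exact: measurable_affine.
    exact: past_monotone ax.
  exact: sample_adapted.
split=> //; apply: v_coordwise.
- exact: measurable_affine.
- exact: past_monotone ax'.
- exact: sample_adapted.
- exact: past_monotone av.
Qed.

(** The gradient at x_k is a version of a conditional expectation given the
    past, hence measurable with respect to the past. *)
Lemma grad_adapted k : adapted (past k) (n_ k).
Proof.
move=> i; apply/measurable_EFinP.
exact: is_condexp_measurable (g_unbiased k i).2.
Qed.

(** The gradient is compared with its value at x0 by the Lipschitz bound. *)
Lemma grad_L2 k : L2_vector P (x k) -> L2_vector P (n_ k).
Proof.
move=> x2.
pose Z w := 2 * dotv (grad f x0) (grad f x0)
            + 2 * (L ^+ 2 * dotv (x k w - x0) (x k w - x0)).
have xx0 := L2_vectorB_cst x0 x2.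
apply: (@L2_vector_sqr _ _ _ _ _ _ Z).
- exact: (adapted_random (@past_measurable k) (@grad_adapted k)).
- apply: integrable_funD; first exact: finite_measure_integrable_cst.
  by do 2 apply: integrable_funZ; exact: integrable_dotv.
- move=> w; have := dotvD_sqr_le (grad f x0) (n_ k w - grad f x0).
  rewrite addrC subrK => /le_trans; apply; rewrite lerD2l ler_pM2l//.
  exact: grad_lipschitz_sqr f_S _ _.
Qed.

Lemma noise_bound k : L2_vector P (x k) ->
  L2_vector P (D_ k) /\
  \int[P]_w dotv (D_ k w) (D_ k w)
    <= sigma ^+ 2 * \int[P]_w dotv (n_ k w) (n_ k w).
Proof.
move=> x2; have n2 := grad_L2 x2; have inn := integrable_dotv n2 n2.
have mD : random_vector (D_ k).
  apply: (@coordwiseB _ _ _ [set u | measurable_fun setT u]).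
  - exact: measurable_affine.
  - exact: g_random.
  - exact: L2_vector_random n2.
have [Y [YX Yn]] := g_MNS k.
have iZ := integrable_funZ (sigma ^+ 2) inn.
have Z0 w : 0 <= sigma ^+ 2 * dotv (n_ k w) (n_ k w).
  by rewrite mulr_ge0 ?sqr_ge0 ?dotv_ge0.
have le := condexp_le_integral (@past_measurable k) YX iZ Z0.
have {}le : (\int[P]_w (dotv (D_ k w) (D_ k w))%:E
             <= (\int[P]_w (sigma ^+ 2 * dotv (n_ k w) (n_ k w)))%:E)%E.
  under eq_integral do rewrite -enorm_sqr; apply: le.
  by apply: filterS Yn => w; rewrite enorm_sqr.
have iDD : P.-integrable setT (EFin \o (fun w => dotv (D_ k w) (D_ k w))).
  apply/integrableP; split.
    by apply/measurable_EFinP; exact: measurable_dotv.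
  under eq_integral do rewrite /= ger0_norm ?dotv_ge0//.
  by apply: le_lt_trans le _; rewrite ltry.
split; first exact: L2_vector_sqr iDD _.
rewrite -RintegralZl// -lee_fin; apply: le_trans le.
by rewrite /Rintegral fineK//; exact: integrable_fin_num.
Qed.

Lemma sample_L2 k : L2_vector P (x k) -> L2_vector P (g k).
Proof.
move=> x2.
have := coordwiseD (Lfun2_affine P) (noise_bound x2).1 (grad_L2 x2).
by congr coordwise; apply/funext => w; rewrite /D_ subrK.
Qed.

Lemma trajectory_L2 k : L2_vector P (x k) /\ L2_vector P (v k).
Proof.
have K2 := Lfun2_affine P.
elim: k => [|k [x2 v2]].
  by split; [exact: x0_coordwise|exact: v0_coordwise].
have x2' : L2_vector P (x k.+1) by apply: x_coordwise => //; exact: sample_L2.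
by split=> //; apply: v_coordwise => //; exact: sample_L2.
Qed.

Definition energy k w : R :=
  f (xp k w) - f xstar + gamma k / 2 * dotv (v k w - xstar) (v k w - xstar).

(** The gap f (x_k^+) - f xstar is nonnegative, and the descent inequality from
    x0 bounds it by a quadratic function of x_k^+. *)
Lemma energy_integrable k : P.-integrable setT (EFin \o energy k).
Proof.
have K2 := Lfun2_affine P.
have [x2 v2] := trajectory_L2 k.
have xp2 : L2_vector P (xp k) by apply: xplus_coordwise => //; exact: sample_L2.
have v2' := L2_vectorB_cst xstar v2.
have xp2' := L2_vectorB_cst x0 xp2.
apply: integrable_funD; last by apply: integrable_funZ; exact: integrable_dotv.
pose Z w := f x0 - f xstar + dotv (grad f x0) (xp k w - x0)
            + L / 2 * dotv (xp k w - x0) (xp k w - x0).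
have iZ : P.-integrable setT (EFin \o Z).
  apply: integrable_funD; last by apply: integrable_funZ; exact: integrable_dotv.
  apply: integrable_funD; first exact: finite_measure_integrable_cst.
  by apply: integrable_dotv => //; exact: coordwise_cst.
apply: le_integrable iZ => //.
  apply/measurable_EFinP; apply: measurable_funB; last exact: measurable_cst.
  apply: continuous_random_vector; last exact: L2_vector_random xp2.
  move=> y; apply: differentiable_continuous.
  exact: class_S_differentiable f_S y.
move=> w _ /=; rewrite lee_fin ger0_norm ?subr_ge0//.
apply: le_trans (ler_norm _); rewrite /Z.
have := descent_le L_gt0 mu_ge0 f_S x0 (xp k w); lra.
Qed.

(** The two bounds on eta are those of [noise_coefficients]. *)
Lemma energy_step k (al := alpha k) (gh := gamma k + al * mu)
    (eta := alpha k.+1 * beta k.+1) :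
  0 <= eta ->
  L * (1 + sigma ^+ 2) * eta <= 1 ->
  (1 + sigma ^+ 2) * (al ^+ 2 / gh) + al ^+ 3 * mu / (gh * gamma k)
    <= (1 + al) * eta ->
  (1 + al) * \int[P]_w energy k.+1 w <= \int[P]_w energy k w.
Proof.
move=> eta_ge0 eta_le eta_ge.
have K2 := Lfun2_affine P.
have al0 : 0 < al := alpha_gt0 k; have ga0 := gamma_gt0 k.
have gh0 : 0 < gh by rewrite ltr_wpDr// mulr_ge0// ltW.
have gamma_step : (1 + al) * gamma k.+1 <= gh.
  have := SHANG_gamma xv_SHANG k; rewrite ler_pdivrMr// -/al /gh; lra.
have [x2 _] := trajectory_L2 k.+1; have [_ v2] := trajectory_L2 k.
have [ax _] := trajectory_adapted k.+1; have [_ av] := trajectory_adapted k.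
have n2 := grad_L2 x2; have [D2 DD_le] := noise_bound x2.
pose a := (1 + al) * (L * eta ^+ 2 - eta) + al ^+ 2 / gh.
pose c w := a *: n_ k.+1 w - (al / gh) *:
  (gamma k *: (v k w - xstar) + (al * mu) *: (x k.+1 w - xstar)).
have c_coordwise K : affine_closed K -> coordwise K (n_ k.+1) ->
    coordwise K (v k) -> coordwise K (x k.+1) -> coordwise K c.
  move=> Ka Kn Kv Kx; apply: (coordwiseB Ka); first exact: coordwiseZ.
  apply: (coordwiseZ Ka); apply: (coordwiseD Ka); apply: (coordwiseZ Ka);
    by apply: (coordwiseB Ka) => //; exact: coordwise_cst.
have c2 : L2_vector P c by exact: c_coordwise.
have ac : adapted (past k.+1) c.
  apply: c_coordwise => //; first exact: measurable_affine.
  exact: grad_adapted.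
have Dc0 : \int[P]_w dotv (D_ k.+1 w) (c w) = 0.
  apply: (noise_orthogonal (@past_measurable k.+1) (sample_L2 x2) n2 c2 ac).
  by move=> i; exact: (g_unbiased k.+1 i).2.
pose A := (1 + al) * (L * eta ^+ 2 / 2) + al ^+ 2 / (2 * gh).
pose B := (1 + al) * (eta - L * eta ^+ 2 / 2) - al ^+ 2 / (2 * gh)
          - al ^+ 3 * mu / (2 * gh * gamma k).
have [A_ge0 AB] : 0 <= A /\ sigma ^+ 2 * A <= B.
  exact: noise_coefficients (ltW L_gt0) al0 ga0 gh0 eta_ge0 eta_le eta_ge.
have ienergy j : P.-integrable setT (EFin \o energy j) by exact: energy_integrable.
have iDc := integrable_dotv D2 c2.
have iDD := integrable_funZ A (integrable_dotv D2 D2).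
have inn := integrable_funZ B (integrable_dotv n2 n2).
have iEDc := integrable_funD (ienergy k) iDc.
have iEDcD := integrable_funD iEDc iDD.
have inn' := integrable_funZ (-1) inn.
rewrite -RintegralZl//.
apply: (@le_trans _ _ (\int[P]_w (energy k w + dotv (D_ k.+1 w) (c w)
   + A * dotv (D_ k.+1 w) (D_ k.+1 w)
   + -1 * (B * dotv (n_ k.+1 w) (n_ k.+1 w))))).
  apply: le_Rintegral => //.
  - exact: integrable_funZ (ienergy k.+1).
  - exact: integrable_funD.
  move=> w _; rewrite mulN1r.
  apply: (lyapunov_step (y := xp k w) (X := x k.+1 w) (G := g k.+1 w)
    L_gt0 mu_ge0 f_S al0 ga0 erefl gamma_step) => //.
  - exact: x_minus_xplus.
  - exact: v_recursion.
rewrite RintegralD// RintegralD// RintegralD// Dc0 addr0 !RintegralZl//; last 2 first.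
- exact: integrable_dotv.
- exact: integrable_dotv.
have nn0 : 0 <= \int[P]_w dotv (n_ k.+1 w) (n_ k.+1 w).
  by apply: Rintegral_ge0 => w _; exact: dotv_ge0.
have := ler_wpM2l A_ge0 DD_le; have := ler_wpM2r nn0 AB; lra.
Qed.

End trajectory.

(** * The convergence rates *)

Theorem theorem2p1 (R : realType) (d : nat)
    (dT : measure_display) (T : measurableType dT) (P : probability T R)
    (mu L sigma : R) (f : 'rV[R]_d -> R) (xstar x0 : 'rV[R]_d)
    (alpha beta gamma : nat -> R) (x v g : nat -> T -> 'rV[R]_d)
    (P_complete : measure_is_complete P)
    (mu_ge0 : 0 <= mu) (L_gt0 : 0 < L) (sigma_ge0 : 0 <= sigma)
    (f_S : class_S mu L f)
    (xstar_min : forall y, f xstar <= f y)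
    (alpha_gt0 : forall k, 0 < alpha k)
    (beta_gt0 : forall k, 0 < beta k)
    (gamma_gt0 : forall k, 0 < gamma k)
    (g_random : forall k, random_vector (g k))
    (xv_SHANG : SHANG mu alpha beta gamma x0 x v g)
    (g_unbiased : cond_unbiased P f x g)
    (g_MNS : MNS P f sigma x g)
    (betaE : forall k, beta k = (1 + sigma ^+ 2) * alpha k / gamma k) :
  (forall a : R,
     0 < mu < L ->
     (forall k, alpha k = a) ->
     (forall k, gamma k = mu) ->
     0 < a <= (1 + sigma ^+ 2)^-1 * Num.sqrt (mu / L) ->
     forall k : nat,
       ('E_P[fun w => (f (xplus alpha beta x g k.+1 w) - f xstar
                       + mu / 2 * enorm (v k.+1 w - xstar) ^+ 2)%R]
        <= ((1 + a) ^- k.+1)%:E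
           * 'E_P[fun w => (f (xplus alpha beta x g 0 w) - f xstar
                            + mu / 2 * enorm (v 0%N w - xstar) ^+ 2)%R])%E)
  /\
  (mu = 0 ->
     (forall k, alpha k = 2 / k.+1%:R) ->
     (forall k, gamma k = alpha k ^+ 2 * (1 + sigma ^+ 2) ^+ 2 * L) ->
     forall k : nat,
       ('E_P[fun w => (f (xplus alpha beta x g k.+1 w) - f xstar
                       + gamma k.+1 / 2 * enorm (v k.+1 w - xstar) ^+ 2)%R]
        <= (2 / (k.+2%:R * k.+3%:R))%:E
           * 'E_P[fun w => (f (xplus alpha beta x g 0 w) - f xstar
                            + gamma 0%N / 2 * enorm (v 0%N w - xstar) ^+ 2)%R])%E).
Proof.
have s_gt0 : 0 < 1 + sigma ^+ 2 by rewrite ltr_pwDl ?sqr_ge0.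
have step := energy_step mu_ge0 L_gt0 f_S xstar_min alpha_gt0 gamma_gt0
  g_random xv_SHANG g_unbiased g_MNS.
have eta_ge0 k : 0 <= alpha k * beta k by rewrite mulr_ge0// ltW.
pose e k := \int[P]_w energy f xstar alpha beta gamma x v g k w.
have EE k (c : R) : c = gamma k ->
    ('E_P[fun w => (f (xplus alpha beta x g k w) - f xstar
                    + c / 2 * enorm (v k w - xstar) ^+ 2)%R] = (e k)%:E)%E.
  move=> ->; rewrite -expectationE; last first.
    exact: (energy_integrable mu_ge0 L_gt0 f_S xstar_min alpha_gt0 gamma_gt0
      g_random xv_SHANG g_unbiased g_MNS).
  by congr ('E_P[_])%E; apply/funext => w; rewrite enorm_sqr.
split.
  (* gamma_k = mu: the lower bound on eta reads 1 + sigma^2 + a <=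
     (1 + sigma^2) (1 + a)^2 once the common factor is removed. *)
  move=> a /andP[mu_gt0 _] alphaE gammaE /andP[a_gt0 a_le] k.
  rewrite !EE ?gammaE// -EFinM lee_fin.
  have a1 : 0 < 1 + a by rewrite ltr_pwDl// ltW.
  have eta_le : L * (1 + sigma ^+ 2) * ((1 + sigma ^+ 2) * a ^+ 2 / mu) <= 1.
    have : (1 + sigma ^+ 2) * a <= Num.sqrt (mu / L).
      by rewrite -ler_pdivlMl.
    have sa_ge0 : 0 <= (1 + sigma ^+ 2) * a by rewrite mulr_ge0// ltW.
    have muL_ge0 : 0 <= mu / L by rewrite divr_ge0// ltW.
    rewrite -ler_sqr ?nnegrE ?sqrtr_ge0// sqr_sqrtr// ler_pdivlMr// => le.
    rewrite mulrA ler_pdivrMr// mul1r; apply: le_trans le.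
    by rewrite le_eqVlt; apply/orP; left; apply/eqP; ring.
  have contract j : (1 + a) * e j.+1 <= e j.
    have := step j; rewrite !gammaE !betaE !alphaE gammaE; apply.
    - by have := eta_ge0 j; rewrite betaE alphaE gammaE.
    - rewrite [X in L * _ * X](_ : _ = (1 + sigma ^+ 2) * a ^+ 2 / mu)//; ring.
    have -> : (1 + sigma ^+ 2) * (a ^+ 2 / (mu + a * mu))
        + a ^+ 3 * mu / ((mu + a * mu) * mu)
        = a ^+ 2 / (mu * (1 + a)) * (1 + sigma ^+ 2 + a).
      by field; rewrite !gt_eqF// [X in 0 < X](_ : _ = mu * (1 + a)) ?mulr_gt0//; ring.
    have -> : (1 + a) * (a * ((1 + sigma ^+ 2) * a / mu))
        = a ^+ 2 / (mu * (1 + a)) * ((1 + sigma ^+ 2) * (1 + a) ^+ 2).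
      by field; rewrite !gt_eqF.
    rewrite ler_wpM2l ?divr_ge0 ?sqr_ge0 ?mulr_ge0 ?ltW//.
    have := sqr_ge0 sigma; nra.
  elim: k => [|k IHk]; rewrite exprS invfM -mulrA ler_pdivlMl//.
    by rewrite expr0 invr1 mul1r; exact: contract.
  exact: le_trans (contract _) IHk.
(* mu = 0: here eta = 1 / ((1 + sigma^2) L) for every k, the largest value
   allowed, and the factors (j + 1) / (j + 3) telescope. *)
move=> mu0 alphaE gammaE k.
rewrite !EE// -EFinM lee_fin.
have contract j : (1 + alpha j) * e j.+1 <= e j.
  have aq i : alpha i ^+ 2 / gamma i = ((1 + sigma ^+ 2) ^+ 2 * L)^-1.
    by rewrite gammaE; field; rewrite !gt_eqF.
  have etaE i : alpha i * beta i = ((1 + sigma ^+ 2) * L)^-1.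
    transitivity ((1 + sigma ^+ 2) * (alpha i ^+ 2 / gamma i)).
      by rewrite betaE; ring.
    by rewrite aq; field; rewrite !gt_eqF.
  apply: step => //; rewrite etaE.
    rewrite [X in X <= _](_ : _ = 1)//; field; rewrite !gt_eqF//.
  rewrite mu0 !mulr0 addr0 mul0r addr0 aq.
  rewrite [X in X <= _](_ : _ = ((1 + sigma ^+ 2) * L)^-1); last first.
    by field; rewrite !gt_eqF.
  apply: ler_peMl; first by rewrite invr_ge0 mulr_ge0// ltW.
  by rewrite lerDl ltW.
have decay j : e j.+1 <= j.+1%:R / j.+3%:R * e j.
  rewrite -[_ / _]invf_div mulrC ler_pdivlMr ?divr_gt0// mulrC.
  have -> : j.+3%:R / j.+1%:R = 1 + alpha j.
    have : j.+1%:R != 0 :> R by rewrite pnatr_eq0.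
    by rewrite alphaE -(addn2 j.+1) natrD; move: j.+1%:R => t t0; field.
  exact: contract.
elim: k => [|k IHk].
  by have := decay 0%N; rewrite (_ : 2 / (2 * 3) = 1 / 3)//; field.
apply: le_trans (decay _) _.
rewrite [leRHS](_ : _ = k.+2%:R / k.+4%:R * (2 / (k.+2%:R * k.+3%:R) * e 0%N)).
  by rewrite ler_wpM2l// divr_ge0.
have : [/\ k.+2%:R != 0 :> R, k.+3%:R != 0 :> R & k.+4%:R != 0 :> R].
  by rewrite !pnatr_eq0.
by move: k.+2%:R k.+3%:R k.+4%:R => a b c [a0 b0 c0]; field; rewrite a0 b0.
Qed.
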